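(* Let $(\Omega,\mathcal F,(\mathcal F_t)_{t\in\mathbb N_0})$ be a filtered measurable space, $\mathcal P$ a family of probability measures on $(\Omega,\mathcal F)$, $Q$ a probability measure on $(\Omega,\mathcal F)$, and $I\in(0,\infty)$. For each $k\ge1$ let $\tau_{2^{-k}}$ be an $(\mathcal F_t)$-stopping time with values in $\mathbb N_0\cup\{\infty\}$ such that $\sup_{P\in\mathcal P}P(\tau_{2^{-k}}<\infty)\le2^{-k}$. Define $$M^{\mathrm{dy}}_t:=\frac{6}{\pi^2}\sum_{k=1}^\infty\frac{2^k}{k^2}\,\mathbf 1_{\{\tau_{2^{-k}}\le t\}},\qquad t\in\mathbb N_0.$$ Assume that $\frac{\tau_{2^{-k}}}{k\log2}\to\frac1I$ $Q$-almost surely as $k\to\infty$. Then $M^{\mathrm{dy}}$ is a $\mathcal P$-$e$-process, and $Q$-almost surely as $t\to\infty$, $$\frac1t\log M^{\mathrm{dy}}_t\longrightarrow I.$$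
   Context: A nonnegative adapted process $M=(M_t)_{t\in\mathbb N_0}$ (values in $[0,\infty]$ allowed) is a $\mathcal P$-$e$-process if $\mathbb E_P[M_\sigma]\le1$ for every $P\in\mathcal P$ and every finite $(\mathcal F_t)$-stopping time $\sigma$. Conventions: $\mathbb N_0=\{0,1,2,\dots\}$, $\log0=-\infty$, $\log\infty=\infty$. *)

(* Defs.v *)
From HB Require Import structures.
From mathcomp Require Import all_boot all_order all_algebra.
From mathcomp Require Import all_classical all_reals all_analysis.
From mathcomp Require Import measurable_realfun.

Set Implicit Arguments.
Unset Strict Implicit.
Unset Printing Implicit Defensive.

Import Order.TTheory GRing.Theory Num.Theory.
Import numFieldNormedType.Exports.

Local Open Scope classical_set_scope.
Local Open Scope ring_scope.
Local Open Scope ereal_scope.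

Definition filtration d (T : measurableType d) (F : nat -> set (set T)) : Prop :=
  [/\ forall t, sigma_algebra [set: T] (F t),
      forall t, F t `<=` measurable &
      forall s t, (s <= t)%N -> F s `<=` F t].

(* Times in N_0 U {oo} are encoded in [option nat], with [None] for oo. *)
Definition time_le (x : option nat) (t : nat) : bool :=
  if x is Some n then (n <= t)%N else false.

Definition time_finite (x : option nat) : bool := x != None.

Definition time_ereal (R : realType) (x : option nat) : \bar R :=
  if x is Some n then n%:R%:E else +oo.

Definition stopping_time (T : Type) (F : nat -> set (set T))
    (tau : T -> option nat) : Prop :=
  forall t, F t [set w | time_le (tau w) t].

Definition adapted (R : realType) (T : Type) (F : nat -> set (set T))
    (M : nat -> T -> \bar R) : Prop :=
  forall t (B : set (\bar R)), measurable B -> F t (M t @^-1` B).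

(* A finite stopping time is a stopping time of the form [Some \o sigma]. *)
Definition e_process d (T : measurableType d) (R : realType)
    (F : nat -> set (set T)) (PP : set (probability T R))
    (M : nat -> T -> \bar R) : Prop :=
  [/\ forall t w, 0 <= M t w,
      adapted F M &
      forall (P : probability T R) (sigma : T -> nat),
        PP P -> stopping_time F (fun w => Some (sigma w)) ->
        \int[P]_w M (sigma w) w <= 1].

(* [tau k] stands for the stopping time at level 2^-k; [tau 0] is not used. *)
Definition Mdy (T : Type) (R : realType) (tau : nat -> T -> option nat)
    (t : nat) (w : T) : \bar R :=
  (6 / pi ^+ 2)%:E *
  \sum_(1 <= k <oo) ((2 ^+ k / k%:R ^+ 2)%:E *
                     (\1_[set v | time_le (tau k v) t] w)%:E).

(* Main.v *)
(** The e-process property is monotone convergence: for a finite stopping time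
    sigma, E_P[M_sigma] is at most (6/pi^2) sum_k 2^k/k^2 P(tau_k < oo), hence
    at most (6/pi^2) sum_k 1/k^2 <= 1.  Only the upper bound in Basel's problem
    is needed. It follows from sin x <= x and the closed form of the sum of
    1/sin^2 over the angles (2j+1)pi/2^(n+2), j < 2^n, obtained by iterating
    1/sin^2(x/2) + 1/cos^2(x/2) = 4/sin^2 x.

    For the growth rate, let a < I < b. For large t, tau_k <= t holds for
    k = floor(a t/ln 2), and it fails for every k > b t/ln 2.  The single
    term k gives ln M_t >= k ln 2 - 2 ln k - O(1), the geometric sum
    gives ln M_t <= b t + O(1). *)

Require Import Defs.
From HB Require Import structures.
From mathcomp Require Import all_boot all_order all_algebra.
From mathcomp Require Import all_classical all_reals all_analysis.
From mathcomp Require Import measurable_realfun ring lra zify.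

Set Implicit Arguments.
Unset Strict Implicit.
Unset Printing Implicit Defensive.

Import Order.TTheory GRing.Theory Num.Theory.
Import numFieldNormedType.Exports.

Local Open Scope classical_set_scope.
Local Open Scope ring_scope.

(** * The upper bound in Basel's problem *)

Lemma sin_le_id (R : realType) (x : R) : 0 <= x -> sin x <= x.
Proof.
move=> x0.
have [c _] : exists2 c, c \in `[0, x]%R & sin x - sin 0 = cos c * (x - 0).
  apply: MVT_segment => // ?.
  by apply: continuous_subspaceT => y; exact: continuous_sin.
rewrite sin0 !subr0 => ->.
by rewrite ler_piMl // cos_le1.
Qed.

Lemma invsqr_sin_half (R : realType) (x : R) : sin x != 0 ->
  (sin (x / 2)) ^- 2 + (cos (x / 2)) ^- 2 = 4 * (sin x) ^- 2.
Proof.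
have -> : sin x = cos (x / 2) * sin (x / 2) *+ 2.
  rewrite -sin_mulr2n; congr sin; by field.
set s := sin _; set c := cos _ => sc0.
have [s0 c0] : s != 0 /\ c != 0.
  by move: sc0; rewrite mulrn_eq0 /= mulf_eq0 negb_or => /andP[-> ->].
have -> : s ^- 2 + c ^- 2 = (c ^+ 2 + s ^+ 2) / (s ^+ 2 * c ^+ 2).
  by field; rewrite s0 c0.
by rewrite cos2Dsin2; field; rewrite s0 c0.
Qed.

Lemma odd_angle_itv (R : realType) (n j : nat) : (j < 2 ^ n)%N ->
  0 < (2 * j + 1)%:R * (pi : R) / 2 ^+ n.+2 < pi.
Proof.
move=> jn; have p0 := pi_gt0 R.
rewrite divr_gt0 ?exprn_gt0 ?mulr_gt0 ?ltr0n ?addn1//=.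
rewrite ltr_pdivrMr ?exprn_gt0// mulrC ltr_pM2l// -natrX ltr_nat.
by rewrite !expnS; move: jn; lia.
Qed.

(** Induction on [n]: in the sum at level [n.+1], reversing the second half pairs the angle x/2 with
    pi/2 - x/2, whose sine is cos (x/2). By [invsqr_sin_half] each pair merges into four times the
    term of angle x at level [n]. *)
Lemma sum_invsqr_sin (R : realType) (n : nat) :
  \sum_(0 <= j < 2 ^ n)
     (sin ((2 * j + 1)%:R * pi / 2 ^+ n.+2 : R)) ^- 2 = 2 * 4 ^+ n.
Proof.
elim: n => [|n IHn].
  rewrite expn0 big_nat1 muln0 add0n mul1r.
  (* At x = pi/2 both half-angle terms coincide and add up to 4, so each is 2. *)
  have := @invsqr_sin_half R (pi / 2).
  rewrite sin_pihalf oner_neq0 => /(_ isT).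
  rewrite -[_ / 2 / 2]mulrA -invfM -expr2.
  have -> : cos (pi / 2 ^+ 2) = sin (pi / 2 ^+ 2) :> R.
    rewrite -cosBpihalf -cosN; congr cos; by field.
  by rewrite expr1n invr1 expr0; lra.
rewrite (@big_cat_nat _ _ _ (2 ^ n)) //=; last by rewrite leq_exp2l.
rewrite -{2}[(2 ^ n)%N]add0n big_addn.
rewrite expnS mul2n -addnn addnK.
rewrite [X in _ + X]big_nat_rev /= add0n -big_split /=.
rewrite [4 ^+ n.+1]exprS mulrCA -IHn big_distrr /= !big_nat.
apply: eq_bigr => j /andP[_ jn].
set x := (2 * j + 1)%:R * pi / 2 ^+ n.+2.
have x_itv : 0 < x < pi := odd_angle_itv R jn.
rewrite -invsqr_sin_half ?gt_eqF ?sin_gt0_pi//; congr (_ + _).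
  by congr (sin _ ^- 2); rewrite /x [2 ^+ n.+3]exprS invfM; field;
    rewrite expf_neq0.
rewrite -cosBpihalf -cosN; congr (cos _ ^- 2).
have jE : (2 * (2 ^ n - j.+1 + 2 ^ n) + 1)%:R = 4 * 2 ^+ n - (2 * j + 1)%:R :> R.
  rewrite -natrX -natrM -natrB; last by move: jn; lia.
  by congr (_%:R); move: jn; lia.
rewrite /x jE !exprS; field; by rewrite expf_neq0.
Qed.

Lemma sum_invsqr_odd (R : realType) (n : nat) :
  \sum_(0 <= j < 2 ^ n) ((2 * j + 1)%:R ^- 2 : R) <= pi ^+ 2 / 8.
Proof.
have p0 := pi_gt0 R.
(* This factor is (2^(n+2)/pi)^2, which turns (2j+1)^-2 into x^-2 for the angle x; then sin x <= x
   compares termwise. *)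
have p2 : 0 < 16 * 4 ^+ n / pi ^+ 2 :> R by rewrite divr_gt0 ?mulr_gt0 ?exprn_gt0.
rewrite -(ler_pM2l p2).
have -> : 16 * 4 ^+ n / pi ^+ 2 * (pi ^+ 2 / 8) = 2 * 4 ^+ n :> R.
  have := lt0r_neq0 p0; move: (pi : R) (4 ^+ n) => x y x0; by field.
rewrite -sum_invsqr_sin big_distrr /= !big_nat.
apply: ler_sum => j /andP[_ jn].
set x := (2 * j + 1)%:R * pi / 2 ^+ n.+2.
have x_itv : 0 < x < pi := odd_angle_itv R jn.
have -> : 16 * 4 ^+ n / pi ^+ 2 * (2 * j + 1)%:R ^- 2 = x ^- 2.
  have E4 : (2 ^+ n.+2) ^+ 2 = 16 * 4 ^+ n :> R.
    by rewrite -exprM mulnC exprM (_ : 2 ^+ 2 = 4); [rewrite !exprS|]; ring.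
  by rewrite /x !exprMn exprVn E4 !invfM !invrK; ring.
have s0 := sin_gt0_pi x_itv; have [x0 _] := andP x_itv.
rewrite lef_pV2 ?posrE ?exprn_gt0// ler_pXn2r ?nnegrE ?(ltW s0) ?(ltW x0)//.
by rewrite sin_le_id // ltW.
Qed.

(** Splitting by parity gives S(2m) = odd part + S(m)/4. At m = 2^n, monotonicity S(m) <= S(2m)
    yields (3/4) S(m) <= pi^2/8, and n <= 2^n concludes. *)
Lemma sum_invsqr_le (R : realType) (n : nat) :
  \sum_(0 <= k < n) (k.+1%:R ^- 2 : R) <= pi ^+ 2 / 6.
Proof.
pose S m : R := \sum_(0 <= k < m) k.+1%:R ^- 2.
have S_mono m p : (m <= p)%N -> S m <= S p.
  move=> mp; rewrite /S [leRHS](@big_cat_nat _ _ _ m)//= lerDl.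
  by apply: sumr_ge0 => i _; rewrite invr_ge0 exprn_ge0.
have S_double m : S (2 * m)%N =
    \sum_(0 <= j < m) (2 * j + 1)%:R ^- 2 + S m / 4.
  rewrite /S; elim: m => [|m IHm]; first by rewrite muln0 !big_geq// mul0r addr0.
  rewrite (_ : 2 * m.+1 = (2 * m).+2)%N; last by lia.
  rewrite !big_nat_recr //= IHm mulrDl -!addrA; congr (_ + _).
  rewrite [RHS]addrCA; congr (_ + _); rewrite addn1; congr (_ + _).
  have -> : (2 * m).+2%:R = 2 * m.+1%:R :> R by rewrite -natrM; congr (_%:R); lia.
  by rewrite exprMn invfM mulrC; congr (_ * _^-1); ring.
have := sum_invsqr_odd R n; have := S_double (2 ^ n)%N.
have := S_mono (2 ^ n)%N (2 * 2 ^ n)%N; have := S_mono n (2 ^ n)%N.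
rewrite (ltnW (ltn_expl _ _))// => /(_ isT); rewrite leq_pmull// => + /(_ isT).
rewrite -/(S n); lra.
Qed.

Local Open Scope ereal_scope.

(** * The e-process property *)

Lemma time_le_indic (T : Type) (R : realType) (tau : T -> option nat)
    (t : nat) (w : T) :
  (\1_[set v | time_le (tau v) t] w : R) = (time_le (tau w) t)%:R.
Proof. by rewrite indicE mem_setE. Qed.

Lemma MdyE (T : Type) (R : realType) (tau : nat -> T -> option nat) t w :
  Mdy R tau t w = (6 / pi ^+ 2)%:E *
    \sum_(0 <= k <oo) ((2 ^+ k.+1 / k.+1%:R ^+ 2)%:E *
                       (time_le (tau k.+1 w) t)%:R%:E).
Proof.
rewrite /Mdy; congr (_ * _).
rewrite -nneseries_addn; last first.
  by move=> k; rewrite -EFinM lee_fin mulr_ge0// divr_ge0// exprn_ge0.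
by apply: eq_eseriesr => k _; rewrite addn1 time_le_indic.
Qed.

Lemma weight_ge0 (R : realType) k : (0 <= 2 ^+ k.+1 / k.+1%:R ^+ 2 :> R)%R.
Proof. by rewrite divr_ge0// exprn_ge0. Qed.

Lemma measurable_fun_weighted_indic d (T : measurableType d) (R : realType)
    (a : R) (A : set T) :
  measurable A -> measurable_fun [set: T] (fun w => a%:E * (\1_A w)%:E).
Proof.
move=> mA; apply: measurable_funeM; apply/measurable_EFinP.
exact: measurable_indic.
Qed.

Lemma measurable_fun_weighted_sum d (T : measurableType d) (R : realType)
    (c : R) (a : R^nat) (A : nat -> set T) :
  (forall k, 0 <= a k)%R -> (forall k, measurable (A k)) ->
  measurable_fun [set: T]
    (fun w => c%:E * \sum_(0 <= k <oo) ((a k)%:E * (\1_(A k) w)%:E)).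
Proof.
move=> a0 mA; apply: measurable_funeM.
apply: ge0_emeasurable_sum => [k w _ _|k _].
  by rewrite mule_ge0// lee_fin.
exact: measurable_fun_weighted_indic.
Qed.

Lemma integral_weighted_sum d (T : measurableType d) (R : realType)
    (P : {measure set T -> \bar R}) (c : R) (a : R^nat) (A : nat -> set T) :
  (0 <= c)%R -> (forall k, 0 <= a k)%R -> (forall k, measurable (A k)) ->
  \int[P]_w (c%:E * \sum_(0 <= k <oo) ((a k)%:E * (\1_(A k) w)%:E)) =
  c%:E * \sum_(0 <= k <oo) ((a k)%:E * P (A k)).
Proof.
move=> c0 a0 mA.
have aA0 k w : 0 <= (a k)%:E * (\1_(A k) w)%:E by rewrite mule_ge0// lee_fin.
rewrite ge0_integralZl//; first last.
- by move=> w _; exact: nneseries_ge0.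
- apply: ge0_emeasurable_sum => // k _; exact: measurable_fun_weighted_indic.
rewrite integral_nneseries//; last first.
  by move=> k; exact: measurable_fun_weighted_indic.
congr (_ * _); apply: eq_eseriesr => k _.
rewrite ge0_integralZl ?lee_fin// ?integral_indic ?setIT//.
by apply/measurable_EFinP; exact: measurable_indic.
Qed.

(** The complement is the union over t of the events sigma <= t < tau, each a difference of two sets
    of [F t]. *)
Lemma measurable_le_stopping d (T : measurableType d) (F : nat -> set (set T))
    (tau : T -> option nat) (sigma : T -> nat) :
  filtration F -> stopping_time F tau ->
  stopping_time F (fun w => Some (sigma w)) ->
  measurable [set w | time_le (tau w) (sigma w)].
Proof.
move=> [_ mF _] tauF sigmaF.
have -> : [set w | time_le (tau w) (sigma w)] =
    ~` \bigcup_t ([set w | time_le (Some (sigma w)) t] `\`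
                   [set w | time_le (tau w) t]).
  apply/seteqP; split => w /=.
    move=> tau_sigma [t _] /= [sigma_t]; apply.
    by case: (tau w) tau_sigma => //= n /leq_trans; exact.
  apply: contra_notP => tau_sigma; exists (sigma w) => //.
  by split => //=.
apply: measurableC; apply: bigcupT_measurable => t.
apply: measurableD; exact: mF.
Qed.

Lemma measurable_time_finite d (T : measurableType d) (F : nat -> set (set T))
    (tau : T -> option nat) :
  filtration F -> stopping_time F tau -> measurable [set w | time_finite (tau w)].
Proof.
move=> [_ mF _] tauF.
have -> : [set w | time_finite (tau w)] = \bigcup_t [set w | time_le (tau w) t].
  apply/seteqP; split => w /=.
    by case E : (tau w) => [n|//] _; exists n => //=; rewrite E /=.
  by case=> t _ /=; case: (tau w).
apply: bigcupT_measurable => t; exact: mF.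
Qed.

Lemma Mdy_ge0 (T : Type) (R : realType) (tau : nat -> T -> option nat) t w :
  0 <= Mdy R tau t w.
Proof.
rewrite MdyE mule_ge0//; first by rewrite lee_fin divr_ge0// sqr_ge0.
by apply: nneseries_ge0 => k _ _; rewrite mule_ge0// lee_fin ?weight_ge0.
Qed.

Lemma Mdy_adapted d (T : measurableType d) (R : realType)
    (F : nat -> set (set T)) (tau : nat -> T -> option nat) :
  filtration F -> (forall k, (1 <= k)%N -> stopping_time F (tau k)) ->
  adapted F (Mdy R tau).
Proof.
move=> [sF _ _] tauF t B mB.
(* Adaptedness is measurability with respect to [F t], so the carrier is equipped with [F t] as its
   own measurable structure and the general lemma applies there. *)
pose T' := g_sigma_algebraType (F t).
pose A k : set T' := [set w | time_le (tau k.+1 w) t].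
have FE : @measurable _ T' = F t := sigma_algebra_id (sF t).
have mA k : measurable (A k) by rewrite FE; exact: tauF.
have := measurable_fun_weighted_sum (6 / pi ^+ 2) (@weight_ge0 R) mA.
move=> /(_ measurableT B mB); rewrite setTI FE.
congr (F t _); apply: eq_set => w.
by rewrite MdyE; under [in RHS]eq_eseriesr do rewrite -time_le_indic.
Qed.

Lemma Mdy_e_process d (T : measurableType d) (R : realType)
    (F : nat -> set (set T)) (PP : set (probability T R))
    (tau : nat -> T -> option nat) :
  filtration F ->
  (forall k, (1 <= k)%N -> stopping_time F (tau k)) ->
  (forall k, (1 <= k)%N ->
     ereal_sup [set (P : probability T R) [set w | time_finite (tau k w)]
               | P in PP] <= (2 ^- k)%:E) ->
  e_process F PP (Mdy R tau).
Proof.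
move=> hF tauF tauP; split; [exact: Mdy_ge0|exact: Mdy_adapted|].
move=> P sigma PPP sigmaF.
pose A k := [set w | time_le (tau k.+1 w) (sigma w)].
have mA k : measurable (A k) := measurable_le_stopping hF (tauF k.+1 isT) sigmaF.
have PA k : P (A k) <= (2 ^- k.+1)%:E.
  apply: (@le_trans _ _ (P [set w | time_finite (tau k.+1 w)])).
    apply: le_measure; rewrite ?inE//.
      exact: measurable_time_finite hF (tauF _ _).
    by move=> w; rewrite /A /=; case: (tau k.+1 w).
  apply: le_trans (tauP k.+1 isT); apply: ereal_sup_ubound; by exists P.
have c0 : (0 <= 6 / pi ^+ 2 :> R)%R by rewrite divr_ge0// sqr_ge0.
rewrite [leLHS](_ : _ = (6 / pi ^+ 2)%:E *
    \sum_(0 <= k <oo) ((2 ^+ k.+1 / k.+1%:R ^+ 2)%:E * P (A k))); last first.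
  rewrite -integral_weighted_sum//.
  apply: eq_integral => w _; rewrite MdyE; congr (_ * _).
  by apply: eq_eseriesr => k _; rewrite indicE mem_setE.
(* Factoring out the normalising constant reduces the claim to the Basel bound on partial sums. *)
have -> : 1 = (6 / pi ^+ 2)%:E * (pi ^+ 2 / 6)%:E :> \bar R.
  by rewrite -EFinM -invf_div mulVf// mulf_neq0 ?invr_eq0// expf_neq0// gt_eqF//
    pi_gt0.
rewrite lee_wpmul2l//; apply: lime_le.
  by apply: is_cvg_nneseries => k _ _; rewrite mule_ge0// lee_fin weight_ge0.
apply: nearW => n; have := sum_invsqr_le R n.
rewrite -lee_fin -sumEFin; apply: le_trans.
apply: lee_sum => k _.
rewrite (_ : (k.+1%:R ^- 2)%:E = (2 ^+ k.+1 / k.+1%:R ^+ 2)%:E * (2 ^- k.+1)%:E).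
  by rewrite lee_wpmul2l// lee_fin weight_ge0.
by rewrite -EFinM mulrAC divff ?mul1r// expf_neq0.
Qed.

(** * The growth rate along a single path *)

Lemma Mdy_ge (T : Type) (R : realType) (tau : nat -> T -> option nat)
    (n t : nat) w :
  time_le (tau n.+1 w) t ->
  (6 / pi ^+ 2 * (2 ^+ n.+1 / n.+1%:R ^+ 2))%:E <= Mdy R tau t w.
Proof.
move=> tau_t; rewrite MdyE EFinM lee_wpmul2l ?lee_fin ?divr_ge0 ?sqr_ge0//.
have u0 k : 0 <= (2 ^+ k.+1 / k.+1%:R ^+ 2)%:E *
    (time_le (tau k.+1 w) t)%:R%:E :> \bar R.
  by rewrite mule_ge0// lee_fin ?weight_ge0.
apply: le_trans (nneseries_lim_ge n.+1 (fun k _ _ => u0 k)).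
by rewrite big_nat_recr//= tau_t mule1 leeDr// sume_ge0.
Qed.

(** The minimum makes the induction close: the bound doubles while n < N, matching the new term, and
    is constant afterwards. *)
Lemma sum_expr2_lt_le (R : realType) (n N : nat) :
  (\sum_(0 <= k < n) ((k < N)%:R * 2 ^+ k.+1) <= 2 ^+ (minn n N).+1 :> R)%R.
Proof.
elim: n => [|n IHn]; first by rewrite big_nil exprn_ge0.
rewrite big_nat_recr//=.
have [nN|Nn] := ltnP n N.
  move: IHn; rewrite (minn_idPl (ltnW nN)) (minn_idPl nN) mul1r => IHn.
  by rewrite [leRHS]exprS; lra.
by move: IHn; rewrite mul0r addr0 (minn_idPr Nn) (minn_idPr (leqW Nn)).
Qed.

Lemma Mdy_le (T : Type) (R : realType) (tau : nat -> T -> option nat)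
    (N t : nat) w :
  (forall k, time_le (tau k.+1 w) t -> (k < N)%N) ->
  Mdy R tau t w <= (6 / pi ^+ 2 * 2 ^+ N.+1)%:E.
Proof.
move=> tau_t; rewrite MdyE [leRHS]EFinM lee_wpmul2l ?lee_fin ?divr_ge0 ?sqr_ge0//.
apply: lime_le.
  by apply: is_cvg_nneseries => k _ _; rewrite mule_ge0// lee_fin ?weight_ge0.
apply: nearW => n; apply: (@le_trans _ _ (2 ^+ (minn n N).+1)%:E); last first.
  by rewrite lee_fin ler_eXn2l ?ltr1n// ltnS geq_minr.
have := sum_expr2_lt_le R n N; rewrite -lee_fin -sumEFin; apply: le_trans.
apply: lee_sum => k _; rewrite -EFinM lee_fin mulrC.
case: (time_le _ _) (tau_t k) => [/(_ isT) ->|_]; last first.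
  by rewrite mul0r mulr_ge0// exprn_ge0.
rewrite !mul1r ler_pdivrMr ?exprn_gt0// ler_peMr ?exprn_ge0//.
by rewrite exprn_ege1// ler1n.
Qed.

(** Dividing by t makes the additive constants vanish, so affine bounds with slopes arbitrarily
    close to [l] suffice. Half of the tolerance is spent on the slope, half on the constant. *)
Lemma cvg_div_nat (R : realType) (u : (\bar R)^nat) (l : R) : (0 < l)%R ->
  (forall a, (0 < a < l)%R ->
     exists C, \forall t \near \oo, (a * t%:R - C)%:E <= u t) ->
  (forall b, (l < b)%R ->
     exists C, \forall t \near \oo, u t <= (b * t%:R + C)%:E) ->
  ((t%:R^-1)%:E * u t) @[t --> \oo] --> l%:E.
Proof.
move=> l0 lo up.
have key (e : R) : (0 < e)%R -> \forall t \near \oo, exists2 x : R,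
    u t = x%:E & (`|l - t%:R^-1 * x| <= e)%R.
  move=> e0.
  (* The maximum with l/2 keeps the slope positive when [e] is large. *)
  have [|C1 H1] := lo (Num.max (l - e / 2) (l / 2))%R.
    by rewrite lt_max gt_max; lra.
  have [|C2 H2] := up (l + e / 2)%R; first by lra.
  near=> t.
  have t1 : (1 <= t%:R :> R)%R by near: t; exact: nbhs_infty_ger.
  have C1t : (C1 / (e / 2) <= t%:R)%R by near: t; exact: nbhs_infty_ger.
  have C2t : (C2 / (e / 2) <= t%:R)%R by near: t; exact: nbhs_infty_ger.
  have t0 : (0 < t%:R :> R)%R by exact: lt_le_trans t1.
  have L : (Num.max (l - e / 2) (l / 2) * t%:R - C1)%:E <= u t by near: t.
  have U : u t <= ((l + e / 2) * t%:R + C2)%:E by near: t.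
  (* Real bounds on both sides exclude infinite values of [u t]. *)
  move: L U; case: (u t) => [x| |]//; rewrite !lee_fin => L U.
  exists x => //.
  move: C1t C2t; rewrite !ler_pdivrMr ?divr_gt0// => C1t C2t.
  have {}L : ((l - e) * t%:R <= x)%R.
    apply: le_trans L.
    have : (l - e / 2 <= Num.max (l - e / 2) (l / 2))%R by rewrite le_max lexx.
    by move=> /(ler_wpM2r (ltW t0)); lra.
  have {}U : (x <= (l + e) * t%:R)%R by lra.
  rewrite ler_distlC mulrC ler_pdivlMr// ler_pdivrMr//.
  by rewrite L U.
apply/fine_cvgP; split.
  by apply: filterS (key 1%R ltr01) => t [x -> _].
apply/cvgrPdist_le => e /key; apply: filterS => t [x /= -> ?]//.
Unshelve. all: by end_near.
Qed.
(** Since 1/I < 1/a, eventually s_k < k ln 2 / a, which also rules out an infinite time. The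
    threshold on [k] is uniform in [t], because [k] is later chosen as a function of [t]. *)
Lemma near_time_le (R : realType) (s : nat -> option nat) (I a : R) :
  (0 < a < I)%R ->
  (time_ereal R (s k) / (k%:R * ln 2)%:E) @[k --> \oo] --> (1 / I)%:E ->
  \forall k \near \oo, forall t : nat,
    (k%:R * ln 2 <= a * t%:R)%R -> time_le (s k) t.
Proof.
move=> /andP[a0 aI] sI.
have ln20 : (0 < ln 2 :> R)%R by rewrite ln_gt0// ltr1n.
have Ia : (1 / I < a^-1)%R by rewrite div1r ltf_pV2// posrE// (lt_trans a0).
have near_lt := sI _ (@nbhs_open_ereal_lt R (1 / I) (fun=> a^-1)%R Ia).
near=> k => t kt.
have k0 : (0 < k%:R * ln 2 :> R)%R.
  by rewrite mulr_gt0// ltr0n; near: k; exact: nbhs_infty_gt.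
have : time_ereal R (s k) / (k%:R * ln 2)%:E < (a^-1)%:E by near: k.
rewrite inver gt_eqF// lte_pdivrMr//.
case: (s k) => //= n; rewrite -EFinM lte_fin => nk.
rewrite -(ler_nat R); apply: le_trans (ltW nk) _.
by rewrite mulrC ler_pdivrMr// [leRHS]mulrC.
Unshelve. all: by end_near.
Qed.

(** Here 1/b < 1/I gives s_k > k ln 2 / b eventually; an infinite time makes the premise false. *)
Lemma near_time_le_imp (R : realType) (s : nat -> option nat) (I b : R) :
  (0 < I < b)%R ->
  (time_ereal R (s k) / (k%:R * ln 2)%:E) @[k --> \oo] --> (1 / I)%:E ->
  \forall k \near \oo, forall t : nat,
    time_le (s k) t -> (k%:R * ln 2 <= b * t%:R)%R.
Proof.
move=> /andP[I0 Ib] sI.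
have b0 := lt_trans I0 Ib.
have ln20 : (0 < ln 2 :> R)%R by rewrite ln_gt0// ltr1n.
have bI : (b^-1 < 1 / I)%R by rewrite div1r ltf_pV2// posrE.
have near_gt := sI _ (@nbhs_open_ereal_gt R (1 / I) (fun=> b^-1)%R bI).
near=> k => t kt.
have k0 : (0 < k%:R * ln 2 :> R)%R.
  by rewrite mulr_gt0// ltr0n; near: k; exact: nbhs_infty_gt.
have : (b^-1)%:E < time_ereal R (s k) / (k%:R * ln 2)%:E by near: k.
rewrite inver gt_eqF// lte_pdivlMr//.
case: (s k) kt => //= n nt; rewrite -EFinM lte_fin mulrC ltr_pdivrMr// => nk.
by apply: le_trans (ltW nk) _; rewrite mulrC ler_pM2l// ler_nat.
Unshelve. all: by end_near.
Qed.

Lemma lne_Mdy_ge (T : Type) (R : realType) (tau : nat -> T -> option nat)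
    (w : T) (I a : R) :
  (time_ereal R (tau k w) / (k%:R * ln 2)%:E) @[k --> \oo] --> (1 / I)%:E ->
  (0 < a < I)%R ->
  exists C, \forall t \near \oo, (a * t%:R - C)%:E <= lne (Mdy R tau t w).
Proof.
move=> tauI /andP[a0 aI].
have ln20 : (0 < ln 2 :> R)%R by rewrite ln_gt0// ltr1n.
(* The level is chosen with a slope [a1] strictly above [a]; the gap leaves a surplus linear in k
   that pays for 2 ln k. *)
have [a1 aa1 a1_lt] : exists2 a1, (a < a1)%R & (a1 < I)%R.
  by exists ((a + I) / 2)%R; lra.
have a10 : (0 < a1)%R := lt_trans a0 aa1.
have a1I : (0 < a1 < I)%R by rewrite a10.
have [K _ tauK] := near_time_le a1I tauI.
(* [e] is such that 2 e k is exactly the surplus (1 - a/a1) k ln 2. *)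
have [e e0 eE] : exists2 e : R, (0 < e)%R & (2 * e = ln 2 - ln 2 * (a / a1))%R.
  exists (ln 2 * (1 - a / a1) / 2)%R; last by field; rewrite gt_eqF.
  by rewrite divr_gt0// mulr_gt0// subr_gt0 ltr_pdivrMr// mul1r.
have c0 : (0 < 6 / pi ^+ 2 :> R)%R by rewrite divr_gt0// exprn_gt0// pi_gt0.
(* The first summand pays for rounding k down, the last for the constant in 2 ln k < 2 e k - 2 ln
   e. *)
exists (ln 2 * (a / a1) - ln (6 / pi ^+ 2) - 2 * ln e)%R.
near=> t.
pose k := Num.truncn (a1 * t%:R / ln 2).
have x0 : (0 <= a1 * t%:R / ln 2)%R.
  by apply: divr_ge0; [apply: mulr_ge0|]; rewrite ?ler0n ?ltW.
have Kk : (K < k)%N.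
  rewrite truncn_gt_nat ler_pdivlMr// -ler_pdivrMl//.
  by near: t; exact: nbhs_infty_ger.
have /andP[kt tk] := truncn_itv x0.
have k0 : (0 < k)%N by exact: leq_ltn_trans Kk.
have kR0 : (0 < k%:R :> R)%R by rewrite ltr0n.
have tau_t : time_le (tau k.-1.+1 w) t.
  by rewrite prednK//; apply: tauK; [exact: ltnW|rewrite -ler_pdivlMr].
have := Mdy_ge R tau_t; rewrite prednK// => M_ge.
have v0 : (0 < 6 / pi ^+ 2 * (2 ^+ k / k%:R ^+ 2) :> R)%R.
  by rewrite mulr_gt0// divr_gt0// exprn_gt0.
apply: (@le_trans _ _ (lne (6 / pi ^+ 2 * (2 ^+ k / k%:R ^+ 2))%:E)); last first.
  rewrite lee_lne// in_itv/= ?lee_fin ?leey ?andbT ?(ltW v0)//.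
  by rewrite Mdy_ge0.
rewrite lne_EFin// lee_fin; move: (6 / pi ^+ 2)%R c0 => c c0.
rewrite lnM ?posrE ?divr_gt0 ?exprn_gt0//.
rewrite ln_div ?posrE ?exprn_gt0// !lnXn//.
(* [ln x < x] at [x = e k] absorbs the factor [k^-2]: 2 ln k < 2 e k - 2 ln e. *)
have := ln_sublinear (mulr_gt0 e0 kR0); rewrite lnM ?posrE// => lnk.
have {}tk : (a * t%:R <= ln 2 * (a / a1) * (k%:R + 1))%R.
  move: tk; rewrite -/k ltr_pdivrMr// -natr1 => tk.
  have -> : (a * t%:R = a / a1 * (a1 * t%:R))%R by rewrite mulrA divfK// gt_eqF.
  rewrite (mulrC (ln 2)) -[leRHS]mulrA ler_pM2l ?divr_gt0//.
  by rewrite [leRHS]mulrC; exact: ltW.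
have e_k : (2 * e * k%:R = (ln 2 - ln 2 * (a / a1)) * k%:R)%R by rewrite eE.
rewrite -(mulr_natr (ln 2)); lra.
Unshelve. all: by end_near.
Qed.

Lemma lne_Mdy_le (T : Type) (R : realType) (tau : nat -> T -> option nat)
    (w : T) (I b : R) :
  (time_ereal R (tau k w) / (k%:R * ln 2)%:E) @[k --> \oo] --> (1 / I)%:E ->
  (0 < I < b)%R ->
  exists C, \forall t \near \oo, lne (Mdy R tau t w) <= (b * t%:R + C)%:E.
Proof.
move=> tauI Ib; have /andP[I0 /(lt_trans I0) b0] := Ib.
have ln20 : (0 < ln 2 :> R)%R by rewrite ln_gt0// ltr1n.
have [K _ tauK] := near_time_le_imp Ib tauI.
have c0 : (0 < 6 / pi ^+ 2 :> R)%R by rewrite divr_gt0// exprn_gt0// pi_gt0.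
(* The summand ln 2 comes from the exponent N + 1, as N ln 2 <= b t. *)
exists (ln (6 / pi ^+ 2) + ln 2)%R.
near=> t.
pose N := Num.truncn (b * t%:R / ln 2).
have x0 : (0 <= b * t%:R / ln 2)%R.
  by apply: divr_ge0; [apply: mulr_ge0|]; rewrite ?ler0n ?ltW.
have Kt : (K%:R <= b * t%:R / ln 2)%R.
  by rewrite ler_pdivlMr// -ler_pdivrMl//; near: t; exact: nbhs_infty_ger.
have M_le : Mdy R tau t w <= (6 / pi ^+ 2 * 2 ^+ N.+1)%:E.
  apply: Mdy_le => k tau_t.
  rewrite truncn_gt_nat.
  (* Levels below the threshold [K] escape [tauK], but they lie below b t / ln 2 once t is large. *)
  have [Kk|kK] := leqP K k.+1; first by rewrite ler_pdivlMr//; exact: tauK.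
  by apply: le_trans Kt; rewrite ler_nat ltnW.
have v0 : (0 < 6 / pi ^+ 2 * 2 ^+ N.+1 :> R)%R by rewrite mulr_gt0// exprn_gt0.
apply: (@le_trans _ _ (lne (6 / pi ^+ 2 * 2 ^+ N.+1)%:E)).
  rewrite lee_lne// in_itv/= ?lee_fin ?leey ?andbT ?(ltW v0)//.
  by rewrite Mdy_ge0.
rewrite lne_EFin// lee_fin lnM ?posrE ?exprn_gt0// lnXn// -mulr_natr -natr1.
have := truncn_le (b * t%:R / ln 2); rewrite x0 -/N ler_pdivlMr//; lra.
Unshelve. all: by end_near.
Qed.

Lemma Mdy_growth_rate (T : Type) (R : realType) (tau : nat -> T -> option nat)
    (w : T) (I : R) : (0 < I)%R ->
  (time_ereal R (tau k w) / (k%:R * ln 2)%:E) @[k --> \oo] --> (1 / I)%:E ->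
  ((t%:R^-1)%:E * lne (Mdy R tau t w)) @[t --> \oo] --> I%:E.
Proof.
move=> I0 tauI; apply: cvg_div_nat => // [a|b Ib]; first exact: lne_Mdy_ge.
by apply: lne_Mdy_le tauI _; rewrite I0.
Qed.

Theorem proposition4p5 (R : realType) (d : measure_display)
    (T : measurableType d) (F : nat -> set (set T))
    (PP : set (probability T R)) (Q : probability T R) (I : R)
    (tau : nat -> T -> option nat)
    (hF : filtration F)
    (hI : (0 < I)%R)
    (htau : forall k, (1 <= k)%N -> stopping_time F (tau k))
    (hPP : forall k, (1 <= k)%N ->
      ereal_sup [set (P : probability T R) [set w | time_finite (tau k w)]
                | P in PP] <= (2 ^- k)%:E)
    (hQ : \forall w \ae Q,
      (time_ereal R (tau k w) / (k%:R * ln 2)%:E) @[k --> \oo] --> (1 / I)%:E) :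
  e_process F PP (Mdy R tau) /\
  \forall w \ae Q,
    ((t%:R^-1)%:E * lne (Mdy R tau t w)) @[t --> \oo] --> I%:E.
Proof.
split; first exact: Mdy_e_process.
by apply: filterS hQ => w; exact: Mdy_growth_rate.
Qed.
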